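(* Let $k$ be a field. Every $L$-algebra over $k$ can be embedded into a simple $L$-algebra over $k$.
   Context: An $L$-algebra over $k$ is a $k$-vector space $L$ with two bilinear operations $\prec,\succ:L\times L\to L$ satisfying $(x\succ y)\prec z=x\succ(y\prec z)$ for all $x,y,z\in L$. Homomorphisms are linear maps preserving both operations; an embedding is an injective homomorphism. An ideal is a subspace $I$ with $a\prec f,\ f\prec a,\ a\succ f,\ f\succ a\in I$ for all $f\in I$, $a\in L$. A (nonzero) $L$-algebra is simple if its only ideals are $0$ and itself. *)

(* Defs.v *)
From HB Require Import structures.
From mathcomp Require Import all_boot all_order all_algebra.

Set Implicit Arguments.
Unset Strict Implicit.
Unset Printing Implicit Defensive.

Import GRing.Theory.
Local Open Scope ring_scope.

(* L-algebras with two operations; unrelated to MathComp's lalgType (left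
   algebras), hence the distinct name. *)
Record LAlg (k : fieldType) := MkLAlg {
  LAlg_sort :> lmodType k;
  lprec : {bilinear LAlg_sort -> LAlg_sort -> LAlg_sort};
  lsucc : {bilinear LAlg_sort -> LAlg_sort -> LAlg_sort};
  lsucc_lprecA : forall x y z : LAlg_sort,
    lprec (lsucc x y) z = lsucc x (lprec y z)
}.

Arguments lprec {k L} : rename.
Arguments lsucc {k L} : rename.

Definition is_LAlg_hom (k : fieldType) (L M : LAlg k) (f : L -> M) : Prop :=
  [/\ linear f,
      forall x y : L, f (lprec x y) = lprec (f x) (f y)
    & forall x y : L, f (lsucc x y) = lsucc (f x) (f y)].

Definition is_LAlg_embedding (k : fieldType) (L M : LAlg k) (f : L -> M) : Prop :=
  is_LAlg_hom f /\ injective f.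

(* Prop-valued, so that arbitrary (not only decidable) subspaces are covered. *)
Definition is_subspace (k : fieldType) (V : lmodType k) (I : V -> Prop) : Prop :=
  [/\ I 0,
      forall u v : V, I u -> I v -> I (u + v)
    & forall (c : k) (v : V), I v -> I (c *: v)].

Definition is_LAlg_ideal (k : fieldType) (L : LAlg k) (I : L -> Prop) : Prop :=
  is_subspace I /\
  (forall a f : L, I f ->
    [/\ I (lprec a f), I (lprec f a), I (lsucc a f) & I (lsucc f a)]).

Definition is_LAlg_simple (k : fieldType) (L : LAlg k) : Prop :=
  (exists x : L, x <> 0) /\
  (forall I : L -> Prop, is_LAlg_ideal I ->
    (forall x : L, I x <-> x = 0) \/ (forall x : L, I x)).

(* Main.v *)
Require Import Defs.
From HB Require Import structures.
From mathcomp Require Import all_boot all_order all_algebra.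
From mathcomp Require Import boolp classical_sets functions.

(** Writing x > y = S(x) y and y < z = P(z) y, an L-algebra is a vector space
    with two linear families S, P of endomorphisms such that every S(x)
    commutes with every P(z).  Functions of words give such families for free:
    S acts on the values and P on the arguments.

    Let V = L * k, and let M be the space of functions m from words over L to V
    that are linear in each letter.  For m(nil) = (y, c), let P(m) send n to
    the function w |-> n(y :: w), and let S(m) compose n with the endomorphism
    u |-> c u + (y > u.1, 0) of V.  This makes M an L-algebra.  The element
    x of L is encoded as the function sending a word z1 ... zn to
    ((..(x < z1) < ..) < zn, 0).  Its value at nil is (x, 0), so the encoding
    is injective; it respects < by construction and > by the defining identity
    of L-algebras.

    M is simple.  Let I be an ideal with a nonzero element f, say f(w) <> 0.
    Operating on f with the P's of the letters of w gives an element of I that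
    does not vanish at nil ([ideal_nil_neq0]).  Let (y, c) be its value there.
    If y = 0 then c <> 0.  If y <> 0, a linear functional h on L with h(y) = 1
    ([separating_functional], by Zorn) gives the element m of M whose only
    nonzero values are m(x) = (0, h(x)) on one-letter words, and P of the given
    element of I sends m to an element of I with value (0, 1) at nil.
    Either way I has an element g with g(nil) = (0, c) and c <> 0
    ([ideal_scalar_nil]).  Now S(g) is multiplication by c, so S(g) m in I gives m in I, for all m. *)

Set Implicit Arguments.
Unset Strict Implicit.
Unset Printing Implicit Defensive.

Import GRing.Theory.
Local Open Scope ring_scope.
Local Open Scope classical_set_scope.

(** * Linear functionals on arbitrary vector spaces *)

Section SeparatingFunctional.
Variables (k : fieldType) (V : lmodType k).

(** A subspace maximal among those avoiding v is a hyperplane complementary to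
    the line of v: enlarging it by any x outside captures v. *)
Lemma maximal_subspace_avoiding (v : V) : v <> 0 ->
  exists A : set V,
    [/\ A 0, ~ A v,
        forall c x y, A x -> A y -> A (c *: x + y)
      & forall x, ~ A x -> exists c, A (v - c *: x)].
Proof.
move=> v0.
pose P : set (set V) :=
  [set A | (forall c x y, A x -> A y -> A (c *: x + y)) /\ ~ A v].
have [F FP Ftot|A [[Alin Av] Amax]] := @Zorn_bigcup V P.
  split=> [c x y [X FX Xx] [Y FY Yy]|[X FX Xv]]; last by case: (FP _ FX).
  have [XY|YX] := Ftot _ _ FX FY.
    by exists Y => //; apply: (FP _ FY).1 => //; apply: XY.
  by exists X => //; apply: (FP _ FX).1 => //; apply: YX.
(* P holds of the empty set too, as the union of the empty chain requires.
   Hence A is not yet known to contain 0, and A0 is used in its place. *)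
pose A0 a := A a \/ a = 0.
have A0lin c x y : A0 x -> A0 y -> A0 (c *: x + y).
  move=> [Ax|->]; last by rewrite scaler0 add0r.
  move=> [Ay|->]; first by left; apply: Alin.
  left; rewrite addr0; have {1}-> : c *: x = (c - 1) *: x + x.
    by rewrite scalerBl scale1r subrK.
  exact: Alin.
have ext x : ~ A x -> exists c, A0 (v - c *: x).
  move=> nAx; apply: contrapT => nv.
  apply: (Amax [set z | exists c, A0 (z - c *: x)]).
    split=> [z Az|/(_ x) sub]; first by exists 0; rewrite scale0r subr0; left.
    by apply: nAx; apply: sub; exists 1; rewrite scale1r subrr; right.
  split=> // c y z [d yd] [e ze]; exists (c * d + e).
  have -> : c *: y + z - (c * d + e) *: x = c *: (y - d *: x) + (z - e *: x).
    by rewrite scalerBr scalerDl scalerA opprD addrACA.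
  exact: A0lin.
have A_0 : A 0.
  apply: contrapT => /ext[c]; rewrite scaler0 subr0.
  by case.
exists A; split=> // x /ext[c [Ac|c0]]; exists c => //.
by rewrite c0.
Qed.

(** The functional reads off the coordinate along v modulo the complementary
    hyperplane of [maximal_subspace_avoiding]. *)
Lemma separating_functional (v : V) : v <> 0 ->
  exists h : V -> k, scalar h /\ h v = 1.
Proof.
move=> /maximal_subspace_avoiding[A [A0 Av Alin Amax]].
have AB x y : A x -> A y -> A (y - x).
  by move=> Ax Ay; rewrite -scaleN1r addrC; apply: Alin.
have Av0 c : A (c *: v) -> c = 0.
  move=> Ac; apply: contrapT => /eqP c0; apply: Av.
  have -> : v = c^-1 *: (c *: v) + 0 by rewrite scalerA mulVf // scale1r addr0.
  exact: Alin.
have /choice[h hP] x : exists c, A (x - c *: v).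
  have [Ax|/[dup] nAx /Amax[c Ac]] := pselect (A x).
    by exists 0; rewrite scale0r subr0.
  have c0 : c != 0.
    by apply: contra_notN Av => /eqP c0; rewrite c0 scale0r subr0 in Ac.
  exists c^-1.
  have -> : x - c^-1 *: v = (- c^-1) *: (v - c *: x) + 0.
    by rewrite addr0 scalerBr !scaleNr scalerA mulVf // scale1r opprK addrC.
  exact: Alin.
have huniq x c : A (x - c *: v) -> h x = c.
  move=> Ac; apply/eqP; rewrite -subr_eq0; apply/eqP/Av0.
  have -> : (h x - c) *: v = (x - c *: v) - (x - h x *: v).
    by rewrite scalerBl opprB [RHS]addrC addrA subrK.
  exact: AB.
exists h; split=> [c x y|]; last by apply: huniq; rewrite scale1r subrr.
apply: huniq.
have -> : c *: x + y - (c * h x + h y) *: v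
        = c *: (x - h x *: v) + (y - h y *: v).
  by rewrite scalerBr scalerDl scalerA opprD addrACA.
exact: Alin.
Qed.

End SeparatingFunctional.

(** * The space of multilinear functions of words *)

Section MultilinearMaps.
Variables (k : fieldType) (U V : lmodType k).

Definition multilinear (m : seq U -> V) : Prop :=
  forall w1 w2 c x y, m (w1 ++ (c *: x + y) :: w2)
    = c *: m (w1 ++ x :: w2) + m (w1 ++ y :: w2).

Definition multilinear_pred : pred (seq U -> V) :=
  fun m => `[< multilinear m >].

Lemma multilinear_closed : subsemimod_closed multilinear_pred.
Proof.
apply: GRing.submod_closed_semi; split.
  by apply/asboolP => w1 w2 c x y; rewrite /= scaler0 addr0.
move=> a m n /asboolP mP /asboolP nP; apply/asboolP => w1 w2 c x y.
have E w : (a *: m + n) w = a *: m w + n w by [].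
by rewrite !E mP nP !scalerDr !scalerA [a * c]mulrC addrACA.
Qed.

Record multimap := MultiMap { mmfun :> seq U -> V; _ : multilinear_pred mmfun }.

HB.instance Definition _ := [isSub for mmfun].
HB.instance Definition _ := [Choice of multimap by <:].
HB.instance Definition _ :=
  GRing.SubChoice_isSubLmodule.Build k (seq U -> V) multilinear_pred multimap
    multilinear_closed.

Definition mkmulti m (mP : multilinear m) : multimap := MultiMap (asboolT mP).

Lemma multimapP (m : multimap) : multilinear m.
Proof. exact: asboolW (valP m). Qed.

Lemma multimap_eqP (m n : multimap) : m =1 n -> m = n.
Proof. by move=> mn; apply: val_inj; apply/funext. Qed.

Lemma multimapDZ c (m n : multimap) w : (c *: m + n) w = c *: m w + n w.
Proof. by rewrite -[LHS]/(val _ w) linearP. Qed.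

Lemma multimap0 w : (0 : multimap) w = 0.
Proof. by rewrite -[LHS]/(val _ w) raddf0. Qed.

End MultilinearMaps.

(** * The simple L-algebra containing L *)

Section SimpleHull.
Variables (k : fieldType) (L : LAlg k).

Let V : lmodType k := (L * k^o)%type.
Let M := multimap L V.
Implicit Types (m n f g : M) (u v : V) (x y z : L) (w : seq L).

(** The k-component of v acts as a scalar on all of V, which makes elements
    with value (0, c) at nil, c <> 0, act invertibly; the L-component acts on L
    by lsucc and kills the summand k. *)
Definition hull_act (v u : V) : V :=
  (v.2 *: u.1 + lsucc v.1 u.1, v.2 * u.2).

Lemma hull_actPr v : linear (hull_act v).
Proof.
move=> c u1 u2; congr pair => /=; last by rewrite mulrDr mulrCA.
by rewrite linearPr !scalerDr !scalerA [_ * c]mulrC addrACA.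
Qed.

Lemma hull_actPl u : linear (hull_act^~ u).
Proof.
move=> c v1 v2; congr pair => /=; last by rewrite mulrDl -scalerAl.
by rewrite linearPl scalerDl !scalerDr !scalerA addrACA.
Qed.

Lemma hull_prec_multilinear m n : multilinear (fun w => m ((n [::]).1 :: w)).
Proof. by move=> w1 w2 c x y; rewrite -!cat_cons multimapP. Qed.

Definition hull_prec m n : M := mkmulti (hull_prec_multilinear m n).

Lemma hull_precE m n w : hull_prec m n w = m ((n [::]).1 :: w).
Proof. by []. Qed.

Lemma hull_succ_multilinear m n :
  multilinear (fun w => hull_act (m [::]) (n w)).
Proof. by move=> w1 w2 c x y; rewrite multimapP hull_actPr. Qed.

Definition hull_succ m n : M := mkmulti (hull_succ_multilinear m n).

Lemma hull_succE m n w : hull_succ m n w = hull_act (m [::]) (n w).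
Proof. by []. Qed.

Lemma hull_prec_bilinear : bilinear_for *:%R *:%R hull_prec.
Proof.
split=> [n|m] c f g; apply: multimap_eqP => w; rewrite multimapDZ.
  exact: multimapDZ.
rewrite !hull_precE multimapDZ.
exact: (@multimapP _ _ _ m [::] w).
Qed.

Lemma hull_succ_bilinear : bilinear_for *:%R *:%R hull_succ.
Proof.
split=> [n|m] c f g; apply: multimap_eqP => w;
  rewrite multimapDZ !hull_succE multimapDZ.
  exact: hull_actPl.
exact: hull_actPr.
Qed.

HB.instance Definition _ :=
  bilinear_isBilinear.Build k M M M *:%R *:%R hull_prec hull_prec_bilinear.
HB.instance Definition _ :=
  bilinear_isBilinear.Build k M M M *:%R *:%R hull_succ hull_succ_bilinear.

(** The left operation changes values only and the right one arguments only,
    so both sides are the same function by computation. *)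
Lemma hull_precA f g n :
  hull_prec (hull_succ f g) n = hull_succ f (hull_prec g n).
Proof. exact: multimap_eqP. Qed.

Definition hull : LAlg k := MkLAlg hull_precA.

Lemma hull_embed_multilinear x :
  multilinear (fun w => (foldl lprec x w, 0) : V).
Proof.
move=> w1 w2 c y z; congr pair => /=; last by rewrite scaler0 addr0.
rewrite !foldl_cat /= linearPr.
elim: w2 (lprec _ y) (lprec _ z) => //= t w2 IH a b.
by rewrite linearPl IH.
Qed.

Definition hull_embed x : M := mkmulti (hull_embed_multilinear x).

(** For lsucc, the induction on the word w moves x > _ outwards past the letters
    of w one at a time; each move is the axiom of L-algebras. *)
Lemma hull_embedP : @is_LAlg_embedding k L hull hull_embed.
Proof.
split; last by move=> x y /(congr1 (fun m : M => (m [::]).1)).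
split=> [c x y|x y|x y]; apply: multimap_eqP => w.
- rewrite multimapDZ; congr pair => /=; last by rewrite scaler0 addr0.
  by elim: w x y => //= z w IH x y; rewrite linearPl IH.
- by [].
- congr pair => /=; last by rewrite mul0r.
  rewrite scale0r add0r.
  by elim: w y => //= z w IH y; rewrite lsucc_lprecA IH.
Qed.

Lemma hull_succ_scalar f m (c : k) :
  f [::] = (0, c) :> V -> hull_succ f m = c *: m.
Proof.
move=> fc; apply: multimap_eqP => w; rewrite -[c *: m]addr0 multimapDZ.
rewrite multimap0 addr0 /= fc /hull_act /= linear0l addr0.
by case: (m w).
Qed.

(** Operating with the encoding of a letter z shifts f to f(z :: _), so the
    letters of w can be consumed one after the other. *)
Lemma ideal_nil_neq0 (I : M -> Prop) f w : @is_LAlg_ideal k hull I ->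
  I f -> f w <> 0 -> exists2 g, I g & g [::] <> 0.
Proof.
move=> idI; elim: w f => [|z w IH] f If fw; first by exists f.
apply: (IH (hull_prec f (hull_embed z))) => //.
by have [_ /(_ (hull_embed z) f If)[]] := idI.
Qed.

(** The functions through which a functional on L acts inside the hull; they
    are supported on one-letter words, where multilinearity is linearity. *)
Lemma slot_multilinear (h : L -> k) : scalar h ->
  multilinear (fun w => (0, if w is [:: x] then h x else 0) : V).
Proof.
move=> hP w1 w2 c x y; congr pair => /=; first by rewrite scaler0 addr0.
case: w1 => [|a [|b w1]]; case: w2 => [|d w2] /=;
  by rewrite ?hP ?scaler0 ?addr0.
Qed.

(** The L-component y of f(nil) is prefixed to the words on which another
    element m is evaluated, so m can test y with a functional. *)
Lemma ideal_scalar_nil (I : M -> Prop) f : @is_LAlg_ideal k hull I ->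
  I f -> f [::] <> 0 ->
  exists g (c : k), [/\ I g, c != 0 & g [::] = (0, c) :> V].
Proof.
move=> [_ idI] If; case fE: (f [::]) => [y c] yc0.
have [y0|/separating_functional[h [hP hy]]] := pselect (y = 0).
  exists f, c; split=> //; first by apply/eqP => c0; apply: yc0; rewrite y0 c0.
  by rewrite fE y0.
pose m := mkmulti (slot_multilinear hP).
exists (hull_prec m f), 1; split; [|exact: oner_neq0|].
  by have [] := idI m f If.
by rewrite /= fE /= hy.
Qed.

(** Shows that the hull is nonzero, even when L = 0. *)
Lemma unit_multilinear :
  multilinear (fun w => (0, (nilp w)%:R) : V).
Proof.
by move=> w1 w2 c x y; congr pair; case: w1 => /=; rewrite scaler0 addr0.
Qed.

Lemma hull_simple : is_LAlg_simple hull.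
Proof.
split.
  exists (mkmulti unit_multilinear) => /(congr1 (fun m : M => (m [::]).2)).
  by rewrite multimap0 => /eqP; rewrite /= oner_eq0.
move=> I idI.
have [[f [If f0]]|nI] := pselect (exists f, I f /\ f <> 0); [right|left].
  have [w fw] : exists w, f w <> 0.
    apply: contrapT => nf; apply: f0; apply: multimap_eqP => w.
    by rewrite multimap0; apply: contrapT => fw; apply: nf; exists w.
  have [g Ig g0] := ideal_nil_neq0 idI If fw.
  have [e [c [Ie c0 eE]]] := ideal_scalar_nil idI Ig g0.
  move=> m; have [_ /(_ (c^-1 *: m) e Ie)[_ _ _]] := idI.
  rewrite -[lsucc _ _]/(hull_succ _ _) (hull_succ_scalar _ eE).
  by rewrite scalerA mulfV ?scale1r.
move=> f; split=> [If|->]; last by case: idI => -[].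
by apply: contrapT => f0; apply: nI; exists f.
Qed.

End SimpleHull.

Theorem theorem5p9 (k : fieldType) (L : LAlg k) :
  exists (M : LAlg k) (f : L -> M), is_LAlg_simple M /\ is_LAlg_embedding f.
Proof.
exists (hull L), (@hull_embed k L).
by split; [exact: hull_simple | exact: hull_embedP].
Qed.
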